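(* Let $n\ge 1$, let $K,L\subset\mathbb{R}^n$ be non-empty convex bounded sets and let \[ c_{K,L}=\frac{\mathrm{vol}\left(K+L+\left(-\frac{1}{2},\frac{1}{2}\right)^n\right)}{\mathrm{vol}\bigl(K+L+(-1,1)^n\bigr)}\in(0,1). \] Then \[ \mathrm{G}_n(K+L)\,\mathrm{G}_n\bigl(K\cap(-L)\bigr) \leq\binom{2n}{n}\, c_{K,L}\,\mathrm{G}_n\bigl(K+(-1,1)^n\bigr)\,\mathrm{G}_n\bigl(L+(-1,1)^n\bigr). \] In particular, taking $L=-K$, if $0\in K$ then \[ \mathrm{G}_n(K-K) \leq\binom{2n}{n}\, c_{K,-K}\,\frac{\mathrm{G}_n\bigl(K+(-1,1)^n\bigr)^2}{\mathrm{G}_n(K)}. \]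
   Context: For $M\subset\mathbb{R}^n$, $\mathrm{G}_n(M)=|M\cap\mathbb{Z}^n|$ denotes the lattice point enumerator, and $\mathrm{vol}$ is $n$-dimensional Lebesgue measure. For non-empty $A,B\subset\mathbb{R}^n$, $A+B=\{a+b: a\in A,\ b\in B\}$ is the Minkowski sum and $A-B=A+(-B)$, where $-B=\{-b:b\in B\}$. *)

(* Defs.v *)
From HB Require Import structures.
From mathcomp Require Import all_boot all_order all_algebra finmap.
From mathcomp Require Import all_classical all_reals all_analysis.
Import Order.TTheory GRing.Theory Num.Theory numFieldNormedType.Exports.

Set Implicit Arguments.
Unset Strict Implicit.
Unset Printing Implicit Defensive.

Local Open Scope classical_set_scope.
Local Open Scope ring_scope.
Local Open Scope measure_display_scope.

(* Lebesgue measure on 'rV[R]_n is built as an iterated product measure: its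
   carrier [coords R n] is R * (R * (... * unit)) with the product
   sigma-algebra, transported to row vectors by [row_of_coords]. *)
Fixpoint coords_display (R : realType) (n : nat) : measure_display :=
  match n with
  | 0 => default_measure_display
  | m.+1 => measure_prod_display
              (R.-ocitv.-measurable.-sigma, coords_display R m)
  end.

Fixpoint coords (R : realType) (n : nat) :
    measurableType (coords_display R n) :=
  match n with
  | 0 => unit : measurableType _
  | m.+1 => (measurableTypeR R * coords R m)%type : measurableType _
  end.

(* [m1 \x m2] is sigma-finite in the library too, but canonical inference only
   finds its instance for probability measures. *)
Lemma product_measure_sigma_finite d1 d2 (T1 : measurableType d1)
    (T2 : measurableType d2) (R : realType)
    (m1 : {sigma_finite_measure set T1 -> \bar R})
    (m2 : {sigma_finite_measure set T2 -> \bar R}) :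
  sigma_finite setT (m1 \x m2)%E.
Proof.
have /sigma_finiteP[F [TF ndF Foo]] := sigma_finiteT m1.
have /sigma_finiteP[G [TG ndG Goo]] := sigma_finiteT m2.
exists (fun n => F n `*` G n).
  rewrite -setXTT TF TG predeqE => -[x y]; split.
    move=> [/= [n _ Fnx] [k _ Gky]]; exists (maxn n k) => //; split.
    - by move: x Fnx; exact/subsetPset/ndF/leq_maxl.
    - by move: y Gky; exact/subsetPset/ndG/leq_maxr.
  by move=> [n _ []/= ? ?]; split; exists n.
move=> k; have [? ?] := Foo k; have [? ?] := Goo k.
split; first exact: measurableX.
by rewrite product_measure1E// lte_mul_pinfty// ge0_fin_numE.
Qed.

Definition sigma_finite_product d1 d2 (T1 : measurableType d1)
    (T2 : measurableType d2) (R : realType)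
    (m1 : {sigma_finite_measure set T1 -> \bar R})
    (m2 : {sigma_finite_measure set T2 -> \bar R}) :
    {sigma_finite_measure set (T1 * T2)%type -> \bar R} :=
  HB.pack_for {sigma_finite_measure set (T1 * T2)%type -> \bar R} (m1 \x m2)%E
    (@Measure_isSigmaFinite.Build _ _ _ (m1 \x m2)%E
      (product_measure_sigma_finite m1 m2)).

Fixpoint lebesgue_coords (R : realType) (n : nat) :
    {sigma_finite_measure set coords R n -> \bar R} :=
  match n return {sigma_finite_measure set coords R n -> \bar R} with
  | 0 => dirac tt : {sigma_finite_measure set unit -> \bar R}
  | m.+1 => sigma_finite_product (@lebesgue_measure R) (lebesgue_coords R m)
  end.

Fixpoint row_of_coords (R : realType) (n : nat) : coords R n -> 'rV[R]_n :=
  match n return coords R n -> 'rV[R]_n with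
  | 0 => fun _ => 0
  | m.+1 => fun p => row_mx (p.1%:M : 'rV[R]_1) (row_of_coords p.2)
  end.

Definition vol (R : realType) (n : nat) (M : set 'rV[R]_n) : \bar R :=
  lebesgue_coords R n (@row_of_coords R n @^-1` M).

Definition integer_lattice (R : realType) (n : nat) : set 'rV[R]_n :=
  [set x | forall i, x 0 i \is a Num.int].

(* [fset_set] is empty on infinite sets, so this is the cardinality of
   M `&` integer_lattice only when that set is finite, e.g. when M is bounded. *)
Definition lattice_count (R : realType) (n : nat) (M : set 'rV[R]_n) : nat :=
  #|` fset_set (M `&` @integer_lattice R n)|.

Definition minkowski_sum (R : realType) (n : nat) (A B : set 'rV[R]_n) :
    set 'rV[R]_n :=
  [set a + b | a in A & b in B].

Definition set_opp (R : realType) (n : nat) (A : set 'rV[R]_n) :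
    set 'rV[R]_n :=
  [set - a | a in A].

Definition open_cube (R : realType) (n : nat) (r : R) : set 'rV[R]_n :=
  [set x | forall i, - r < x 0 i < r].

Definition cube_vol_ratio (R : realType) (n : nat) (K L : set 'rV[R]_n) : R :=
  fine (vol (minkowski_sum (minkowski_sum K L) (open_cube (1 / 2)))) /
  fine (vol (minkowski_sum (minkowski_sum K L) (open_cube 1))).

(* Main.v *)
(* With C = (-1,1)^n, A = K + C/2 and B = L + C/2, unit cubes around lattice
   points give G(K+L) <= vol(K+L+C/2) = c_{K,L} vol(K+L+C),
   G(K /\ -L) <= vol(A /\ -B), vol A <= G(K+C) and vol B <= G(L+C).  It remains
   to bound vol(K+L+C) vol(A /\ -B) by binom(2n,n) vol A vol B, which is the
   Rogers-Shephard inequality, since K+L+C is contained in A+B.  For that, put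
   f(x) = vol(A /\ (x-B)), whose integral is vol A vol B.  Convexity and the
   scaling of volume yield f(t d) >= (1-t)^n f(0) for d in A+B and t in [0,1].
   Cutting [0,1] into N steps, this bounds f below by a combination of
   indicators of the dilates (k/N)(K+L+C); its integral is a finite sum that is
   bounded below by binom(N,2n) (n!)^2 / N^(2n) times f(0) vol(K+L+C), and
   N -> oo gives the constant binom(2n,n). *)
Require Import Defs.
From HB Require Import structures.
From mathcomp Require Import all_boot all_order all_algebra finmap.
From mathcomp Require Import all_classical all_reals all_analysis.
From mathcomp Require Import measurable_realfun ring lra zify.
Import Order.TTheory GRing.Theory Num.Theory numFieldNormedType.Exports.

Set Implicit Arguments.
Unset Strict Implicit.
Unset Printing Implicit Defensive.

Local Open Scope classical_set_scope.
Local Open Scope ring_scope.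

(** * Affine changes of variables for the iterated Lebesgue measure *)

Lemma measurable_affine (R : realType) (a b : R) :
  measurable_fun [set: measurableTypeR R]
    (fun x => b + a * x : measurableTypeR R).
Proof.
apply: measurable_funD; first exact: measurable_cst.
by apply: measurable_funM => //; exact: measurable_cst.
Qed.

(** Uniqueness of Lebesgue measure: [a] times the pushforward along [x |-> b + a * x] gives every
    interval []c, d]] its length. *)
Lemma lebesgue_measure_affine (R : realType) (a b : R) (A : set R) :
  0 < a -> measurable A ->
  (@lebesgue_measure R [set x | A (b + a * x)%R] =
   a^-1%:E * @lebesgue_measure R A)%E.
Proof.
move=> a0 mA.
pose mu := mscale (NngNum (ltW a0))
  (pushforward (@lebesgue_measure R) (fun x => b + a * x : measurableTypeR R)).
have muE : forall X, measurable X ->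
    lebesgue_measure X = mu (measurable_affine a b) X.
  apply: lebesgue_measure_unique => _ [[c d]] _ <-.
  rewrite /mu /mscale /pushforward /=.
  transitivity (a%:E * @lebesgue_measure R
      [set` `](c - b)%R / a, (d - b)%R / a]%R])%E; last first.
    congr (_ * lebesgue_measure _)%E; apply/seteqP.
    by split=> x /=; rewrite !in_itv /= ltr_pdivrMr // ler_pdivlMr //
      ltrBlDl lerBrDl [x * a]mulrC.
  rewrite !lebesgue_measure_itv /= !lte_fin ltr_pM2r ?invr_gt0 // ltrD2r.
  case: ifP => _; last by rewrite mule0.
  by rewrite -!EFinD -EFinM; congr EFin; field; rewrite gt_eqF.
rewrite [in RHS]muE // /mu /mscale /pushforward /= muleA -EFinM.
by rewrite mulVf ?gt_eqF // mul1e.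
Qed.

(** Written on nested pairs so that measurability and scaling follow by induction on [n]; [a = -1]
    gives the difference map needed for convolutions. *)
Fixpoint coords_add_scale (R : realType) (n : nat) (a : R) :
    coords R n -> coords R n -> coords R n :=
  match n with
  | 0 => fun _ _ => tt
  | m.+1 => fun s t => (s.1 + a * t.1, coords_add_scale a s.2 t.2)
  end.

Lemma row_of_coords_add_scale (R : realType) (n : nat) (a : R)
    (s t : coords R n) :
  row_of_coords (coords_add_scale a s t) =
  row_of_coords s + a *: row_of_coords t.
Proof.
elim: n s t => [|n IH] s t /=; first by rewrite scaler0 addr0.
have -> : (s.1 + a * t.1)%:M = s.1%:M + a *: t.1%:M :> 'rV[R]_1.
  by rewrite scale_scalar_mx raddfD.
by rewrite IH -add_row_mx -scale_row_mx.
Qed.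

Lemma row_of_coords_surj (R : realType) (n : nat) (x : 'rV[R]_n) :
  exists t, row_of_coords t = x.
Proof.
elim: n x => [|n IH] x; first by exists tt; apply/rowP => -[].
have [t tE] := IH (rsubmx (x : 'rV_(1 + n))).
exists ((lsubmx (x : 'rV_(1 + n))) 0 0, t) => /=.
by rewrite tE -mx11_scalar hsubmxK.
Qed.

Lemma measurable_coords_add_scale (R : realType) (n : nat) (a : R) :
  measurable_fun [set: coords R n * coords R n]
    (fun p => coords_add_scale a p.1 p.2).
Proof.
elim: n => [|n IH] /=; first exact: measurable_cst.
apply: measurable_fun_pair.
  apply: measurable_funD; first exact: (measurableT_comp measurable_fst).
  apply: measurable_funM; first exact: measurable_cst.
  exact: (measurableT_comp measurable_fst).
apply: (measurableT_comp IH (g := fun p : coords R n.+1 * coords R n.+1 =>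
  (p.1.2, p.2.2))).
by apply: measurable_fun_pair; exact: (measurableT_comp measurable_snd).
Qed.

Lemma measurable_coords_add_scaler (R : realType) (n : nat) (a : R)
    (s : coords R n) :
  measurable_fun [set: coords R n] (coords_add_scale a s).
Proof.
apply: (measurableT_comp (@measurable_coords_add_scale R n a)
  (g := fun t => (s, t))).
by apply: measurable_fun_pair; [exact: measurable_cst|exact: measurable_id].
Qed.

Lemma measurable_preimageT d1 d2 (T1 : measurableType d1)
    (T2 : measurableType d2) (f : T1 -> T2) (A : set T2) :
  measurable_fun [set: T1] f -> measurable A -> measurable (f @^-1` A).
Proof. by move=> mf mA; rewrite -[X in measurable X]setTI; exact: mf. Qed.

(** Uniqueness of the product measure reduces the claim to rectangles [B x C]: the first factor
    contributes [a^-1] and, by induction, the second [a^-1 ^+ n]. *)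
Lemma lebesgue_coords_add_scale (R : realType) (n : nat) (a : R)
    (s : coords R n) (A : set (coords R n)) :
  0 < a -> measurable A ->
  (lebesgue_coords R n (coords_add_scale a s @^-1` A) =
   (a^-1 ^+ n)%:E * lebesgue_coords R n A)%E.
Proof.
move=> a0; elim: n s A => [|n IH] s A mA.
  rewrite expr0 mul1e; congr (lebesgue_coords _ _ _).
  by apply/seteqP; split=> -[].
have an0 : (0 <= a ^+ n.+1)%R by rewrite exprn_ge0 // ltW.
pose g := coords_add_scale (n := n.+1) a s.
have mg : measurable_fun [set: coords R n.+1] g.
  exact: measurable_coords_add_scaler.
pose mu := mscale (NngNum an0) (pushforward (lebesgue_coords R n.+1) g).
have muE : forall X, measurable X ->
    (@lebesgue_measure R \x lebesgue_coords R n)%E X = mu mg X.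
  apply: product_measure_unique => B C mB mC.
  rewrite /mu /mscale /pushforward /=.
  transitivity ((a ^+ n.+1)%:E * (@lebesgue_measure R \x lebesgue_coords R n)
      ([set x | B (s.1 + a * x)%R] `*` (coords_add_scale a s.2 @^-1` C)))%E.
    by congr (_ * (_ \x _) _)%E; apply/seteqP; split=> -[x y].
  rewrite product_measure1E; last 2 first.
  - apply: (measurable_preimageT
      (f := fun x => s.1 + a * x : measurableTypeR R)) mB.
    exact: measurable_affine.
  - exact: measurable_preimageT (@measurable_coords_add_scaler _ _ _ _) mC.
  rewrite IH // [X in (_ * (X * _))%E](lebesgue_measure_affine s.1 a0 mB).
  have inv_cancel (u v w : R) (x y : \bar R) : u * (v * w) = 1 ->
      (u%:E * (v%:E * x * (w%:E * y)) = x * y)%E.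
    move=> uvw; rewrite [X in (_ * X)%E]muleACA [LHS]muleA.
    by rewrite (_ : (u%:E * (v%:E * w%:E) = 1)%E) ?mul1e // -uvw.
  apply: inv_cancel.
  by rewrite -exprS -exprMn mulfV ?gt_eqF // expr1n.
have inv_cancel (u v : R) (x : \bar R) : u * v = 1 ->
    (u%:E * (v%:E * x) = x)%E.
  by move=> uv; rewrite muleA (_ : (u%:E * v%:E = 1)%E) ?mul1e // -uv.
transitivity ((a^-1 ^+ n.+1)%:E * mu mg A)%E; last by rewrite -muE.
rewrite /mu /mscale /pushforward /=; apply/esym/inv_cancel.
by rewrite -exprMn mulVf ?gt_eqF // expr1n.
Qed.

(** * Volume of boxes and measurability of open sets *)

Definition vol_measurable (R : realType) (n : nat) (M : set 'rV[R]_n) : Prop :=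
  measurable (@row_of_coords R n @^-1` M).

Section volume.
Context {R : realType} {n : nat}.
Implicit Types (M N : set 'rV[R]_n).

Lemma vol_ge0 M : (0 <= vol M)%E.
Proof. exact: measure_ge0. Qed.

Lemma le_vol M N : vol_measurable M -> vol_measurable N -> M `<=` N ->
  (vol M <= vol N)%E.
Proof.
by move=> mM mN MN; apply: le_measure; rewrite ?inE // => x /=; exact: MN.
Qed.

Lemma vol_measurable_affine (a : R) (v : 'rV[R]_n) M :
  vol_measurable M -> vol_measurable [set x | M (v + a *: x)].
Proof.
have [s <-] := row_of_coords_surj v; move=> mM; rewrite /vol_measurable.
rewrite (_ : preimage _ _ =
    coords_add_scale a s @^-1` (@row_of_coords R n @^-1` M)).
  exact: measurable_preimageT (@measurable_coords_add_scaler _ _ _ _) mM.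
by apply/seteqP; split=> x /=; rewrite row_of_coords_add_scale.
Qed.

Lemma vol_affine (a : R) (v : 'rV[R]_n) M : 0 < a -> vol_measurable M ->
  vol [set x | M (v + a *: x)] = ((a^-1 ^+ n)%:E * vol M)%E.
Proof.
have [s <-] := row_of_coords_surj v; move=> a0 mM.
rewrite /vol -(lebesgue_coords_add_scale s a0 mM); congr (lebesgue_coords _ _ _).
by apply/seteqP; split=> x /=; rewrite row_of_coords_add_scale.
Qed.

End volume.

Lemma forall_row_mx (R : realType) (n : nat) (I : 'I_n.+1 -> set R) (x : R)
    (y : 'rV[R]_n) :
  (forall i, I i ((row_mx (x%:M : 'rV_1) y : 'rV_(1 + n)) 0 i)) <->
  I ord0 x /\ forall i, I (lift ord0 i) (y 0 i).
Proof.
have E0 : (row_mx (x%:M : 'rV_1) y : 'rV_(1 + n)) 0 ord0 = x.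
  rewrite (_ : @ord0 n = lshift n (@ord0 0)); last exact: val_inj.
  by rewrite row_mxEl mxE eqxx.
have E1 i : (row_mx (x%:M : 'rV_1) y : 'rV_(1 + n)) 0 (lift ord0 i) = y 0 i.
  rewrite (_ : lift ord0 i = rshift 1 i); last exact: val_inj.
  by rewrite row_mxEr.
split=> [H|[H0 H1] i].
  by split=> [|i]; [have := H ord0; rewrite E0|have := H (lift ord0 i); rewrite E1].
have [j ->|->] := unliftP ord0 i; [by rewrite E1|by rewrite E0].
Qed.

Lemma row_of_coords_box (R : realType) (n : nat) (I : 'I_n.+1 -> set R) :
  @row_of_coords R n.+1 @^-1` [set x | forall i, I i (x 0 i)] =
  I ord0 `*` (@row_of_coords R n @^-1` [set x | forall i, I (lift ord0 i) (x 0 i)]).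
Proof. by apply/seteqP; split=> -[x y] /forall_row_mx. Qed.

Lemma vol_measurable_box (R : realType) (n : nat) (I : 'I_n -> set R) :
  (forall i, measurable (I i)) ->
  vol_measurable [set x : 'rV[R]_n | forall i, I i (x 0 i)].
Proof.
elim: n I => [|n IH] I mI; rewrite /vol_measurable.
  rewrite (_ : preimage _ _ = setT); first exact: measurableT.
  by apply/seteqP; split=> // x _ [].
rewrite row_of_coords_box; apply: measurableX; first exact: mI.
exact: (IH (fun i => I (lift ord0 i))).
Qed.

Lemma vol_box (R : realType) (n : nat) (I : set R) (r : R) :
  measurable I -> (@lebesgue_measure R I = r%:E)%E ->
  (vol [set x : 'rV[R]_n | forall i, I (x 0%R i)] = (r ^+ n)%:E)%E.
Proof.
move=> mI Ir; elim: n => [|n IH].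
  by rewrite /vol /= diracE /= expr0 mem_set // => -[].
rewrite /vol (row_of_coords_box (fun=> I)) /= product_measure1E //; last first.
  exact: (@vol_measurable_box _ _ (fun=> I)).
rewrite exprS EFinM; congr (_ * _)%E; [exact: Ir|exact: IH].
Qed.

(** Stated coordinatewise so that it is a box, to which [vol_measurable_box] applies. *)
Definition sup_ball (R : realType) (n : nat) (x : 'rV[R]_n) (e : R) :
    set 'rV[R]_n :=
  [set y | forall i, `|y 0 i - x 0 i| < e].

Definition sup_open (R : realType) (n : nat) (U : set 'rV[R]_n) : Prop :=
  forall x, U x -> exists2 e, 0 < e & sup_ball x e `<=` U.

Lemma vol_measurable_sup_ball (R : realType) (n : nat) (x : 'rV[R]_n) (e : R) :
  vol_measurable (sup_ball x e).
Proof.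
have -> : sup_ball x e = [set y : 'rV[R]_n |
    forall i, [set` `](x 0 i - e), (x 0 i + e)[%R] (y 0 i)].
  apply/seteqP; split=> y /= H i; have := H i;
  by rewrite in_itv /= ltr_distl.
apply: (vol_measurable_box
  (I := fun i => [set` `](x 0 i - e), (x 0 i + e)[%R])) => i.
exact: measurable_itv.
Qed.

(** [U] is the union of the countably many balls with rational centre and radius that it
    contains. *)
Lemma vol_measurable_sup_open (R : realType) (n : nat) (U : set 'rV[R]_n) :
  sup_open U -> vol_measurable U.
Proof.
move=> oU.
pose c (p : 'rV[rat]_n * rat) := sup_ball (map_mx (@ratr R) p.1) (ratr p.2).
pose F p := if `[< c p `<=` U >] then c p else set0.
have -> : U = \bigcup_p F p.
  apply/seteqP; split=> [x Ux|x [p _]]; last first.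
    by rewrite /F; case: asboolP => // sU; exact: sU.
  have [e e0 xeU] := oU x Ux.
  (* If the centre is within [d] of [x], the rational ball stays within [2 * d < e] of [x]. *)
  have [d /andP[d0 de]] : exists d : rat, 0 < (ratr d : R) < e / 2.
    have [|d] := @rat_in_itvoo R 0 (e / 2); first by rewrite divr_gt0.
    by rewrite in_itv /=; exists d.
  have /choice[q qE] : forall i, exists q : rat, `|x 0 i - ratr q| < ratr d.
    move=> i; have [|q] := @rat_in_itvoo R (x 0 i - ratr d) (x 0 i + ratr d).
      by rewrite ltrBlDr -addrA ltrDl addr_gt0.
    by rewrite in_itv /= => qi; exists q; rewrite distrC ltr_distl.
  pose Q := \row_i q i.
  have xc : c (Q, d) x by move=> i /=; rewrite !mxE.
  exists (Q, d) => //; rewrite /F; case: asboolP => // -[].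
  move=> y yc; apply: xeU => i; have := yc i; have := xc i => /=.
  move=> xi yi; rewrite -(subrKA (map_mx ratr Q 0 i)).
  apply: le_lt_trans (ler_normD _ _) _; rewrite [e]splitr.
  by apply: ltrD; apply: lt_trans de => //; rewrite distrC.
rewrite /vol_measurable preimage_bigcup.
apply: countable_bigcupT_measurable => [|p]; first exact: countableP.
rewrite /F; case: asboolP => _; first exact: vol_measurable_sup_ball.
by rewrite preimage_set0; exact: measurable0.
Qed.

(** * Counting lattice points by unit cells *)

Section lattice_cells.
Context {R : realType} {n : nat}.
Implicit Types (M N : set 'rV[R]_n).

Definition coord_bounded M : Prop :=
  exists B : R, forall x, M x -> forall i, `|x 0 i| <= B.

Lemma finite_lattice M : coord_bounded M ->
  finite_set (M `&` @integer_lattice R n).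
Proof.
move=> [B MB]; pose N := Num.bound B.
(* The shift by [N] codes the integers of [[-N, N]] by [2 * N + 1] ordinals. *)
pose f (k : 'rV['I_(2 * N).+1]_n) : 'rV[R]_n := 
    \row_i ((k 0 i : nat)%:R - N%:R).
apply: (@sub_finite_set _ _ (range f)); last exact/finite_image/finite_finset.
move=> x [Mx Zx].
have /choice[k kE] : forall i, exists j : 'I_(2 * N).+1,
    x 0 i = (j : nat)%:R - N%:R.
  move=> i; have /intrP[m mE] := Zx i.
  have mB : `|m| <= N%:Z.
    rewrite -(ler_int R) intr_norm -mE.
    apply: le_trans (MB _ Mx i) _; rewrite -pmulrn.
    by apply/ltW/archi_boundP/(le_trans (normr_ge0 _) (MB _ Mx i)).
  have mN : (absz (m + N%:Z)%R < (2 * N).+1)%N by lia.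
  exists (Ordinal mN) => /=; rewrite mE.
  by rewrite -[N%:R]pmulrn natr_absz ger0_norm ?rmorphD ?addrK //; lia.
exists (\row_i k i) => //; apply/rowP => i; by rewrite !mxE -kE.
Qed.

(* [b = true] gives half-open cells, which cover the space; [b = false] gives
   open cells, which are contained in open cubes. *)
Variable b : bool.
Let I : set R := [set` Interval (BSide b (- (1 / 2))) (BLeft (1 / 2))].

Definition lattice_cell (z : 'rV[R]_n) : set 'rV[R]_n :=
  [set x | forall i, I (x 0 i - z 0 i)].

Lemma vol_measurable_lattice_cell z : vol_measurable (lattice_cell z).
Proof.
rewrite (_ : lattice_cell z = [set x | lattice_cell 0 (- z + 1 *: x)]).
  apply: vol_measurable_affine.
  rewrite (_ : lattice_cell 0 = [set x : 'rV_n | forall i, I (x 0 i)]).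
    by apply: (vol_measurable_box (I := fun=> I)) => i; exact: measurable_itv.
  by apply/seteqP; split=> x H i; have := H i; rewrite mxE subr0.
apply/seteqP; split=> x H i; have := H i;
by rewrite !mxE subr0 mul1r addrC.
Qed.

Lemma vol_lattice_cell z : vol (lattice_cell z) = 1%E.
Proof.
have m0 : vol_measurable (lattice_cell 0) by exact: vol_measurable_lattice_cell.
rewrite (_ : lattice_cell z = [set x | lattice_cell 0 (- z + 1 *: x)]).
  rewrite vol_affine // invr1 expr1n mul1e.
  rewrite (_ : lattice_cell 0 = [set x : 'rV_n | forall i, I (x 0 i)]).
    rewrite (@vol_box _ _ I 1) ?expr1n //; first exact: measurable_itv.
    rewrite lebesgue_measure_itv /= lte_fin ifT; last by lra.
    by rewrite -EFinB; congr EFin; lra.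
  by apply/seteqP; split=> x H i; have := H i; rewrite mxE subr0.
apply/seteqP; split=> x H i; have := H i;
by rewrite !mxE subr0 mul1r addrC.
Qed.

(** For either [b] the offsets lie in [[-1/2, 1/2)], so the centres of two cells with a common point
    differ by less than [1] in each coordinate. *)
Lemma trivIset_lattice_cell : trivIset (@integer_lattice R n) lattice_cell.
Proof.
move=> z w Zz Zw [x [xz xw]]; apply/rowP => i.
have /intrP[k kE] := Zz i; have /intrP[l lE] := Zw i.
have itvW y : I y -> - (1 / 2) <= y < 1 / 2.
  by rewrite /I /= in_itv /=; case: b => /andP[/= h ->]; rewrite ?h ?ltW.
have /itvW/andP[z1 z2] := xz i; have /itvW/andP[w1 w2] := xw i.
rewrite kE lE in z1 z2 w1 w2 *; congr (_%:~R).
have : k%:~R < (l + 1)%:~R :> R by rewrite rmorphD /=; lra.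
have : l%:~R < (k + 1)%:~R :> R by rewrite rmorphD /=; lra.
by rewrite !ltr_int; lia.
Qed.

(** Finite additivity over disjoint cells of volume [1]. *)
Lemma vol_bigcup_lattice_cell M : finite_set (M `&` @integer_lattice R n) ->
  vol_measurable (\bigcup_(z in M `&` @integer_lattice R n) lattice_cell z) /\
  vol (\bigcup_(z in M `&` @integer_lattice R n) lattice_cell z) =
  (lattice_count M)%:R%:E.
Proof.
move=> fM; rewrite /vol_measurable /vol preimage_bigcup; split.
  apply: fin_bigcup_measurable => // z _; exact: vol_measurable_lattice_cell.
rewrite measure_fin_bigcup //; last 2 first.
- move=> z w [_ Zz] [_ Zw] [x [xz xw]]; apply: trivIset_lattice_cell => //.
  by exists (row_of_coords x).
- move=> z _; exact: vol_measurable_lattice_cell.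
rewrite fsbig_finite //= (eq_bigr (fun=> 1%:E)); last first.
  by move=> z _; exact: vol_lattice_cell.
rewrite sumEFin; congr EFin.
by rewrite /lattice_count big_const_seq count_predT iter_addr addr0.
Qed.

End lattice_cells.

(** The open cells are the balls [sup_ball z (1 / 2)]: disjoint and contained in [N]. *)
Lemma lattice_count_le_vol (R : realType) (n : nat) (M N : set 'rV[R]_n) :
  coord_bounded M -> vol_measurable N ->
  (forall z, M z -> sup_ball z (1 / 2) `<=` N) ->
  ((lattice_count M)%:R%:E <= vol N)%E.
Proof.
move=> bM mN MN; have fM := finite_lattice bM.
have [mU <-] := vol_bigcup_lattice_cell false fM.
apply: le_vol => // x [z [Mz Zz] xz]; apply: (MN z) => // i.
by have := xz i; rewrite /= in_itv /= ltr_norml.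
Qed.

(** Each point of [M] lies in the half-open cell of a nearest lattice point, which must belong to
    [N]. The bound in the hypothesis is non-strict because these cells contain their lower faces. *)
Lemma vol_le_lattice_count (R : realType) (n : nat) (M N : set 'rV[R]_n) :
  coord_bounded N -> vol_measurable M ->
  (forall x z : 'rV[R]_n, M x -> (forall i, `|x 0 i - z 0 i| <= 1 / 2) -> N z) ->
  (vol M <= (lattice_count N)%:R%:E)%E.
Proof.
move=> bN mM MN; have fN := finite_lattice bN.
have [mU <-] := vol_bigcup_lattice_cell true fN.
apply: le_vol => // x Mx.
(* Rounding [x] coordinatewise, with ties going up, to match the half-open cells. *)
pose z : 'rV[R]_n := \row_i (Num.floor (x 0 i + 1 / 2))%:~R.
have xz i : - (1 / 2) <= x 0 i - z 0 i < 1 / 2.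
  have := floor_itv (x 0 i + 1 / 2); rewrite rmorphD /= mxE.
  by move=> /andP[? ?]; apply/andP; split; lra.
exists z; last by move=> i; rewrite /= in_itv /= xz.
split; last by move=> i; rewrite mxE intr_int.
apply: (MN x) => // i; have /andP[h1 h2] := xz i.
by rewrite ler_norml h1 ltW.
Qed.

(** * Binomial sums and the passage to the limit *)

(** Both sides count the [(n + m + 1)]-subsets of [{0, ..., N - 1}]; on the left they are sorted by
    their element [k] with exactly [n] smaller ones. The proof is an induction with Pascal's
    rule. *)
Lemma sum_bin_mul (n m N : nat) :
  (\sum_(k < N) 'C(k, n) * 'C(N.-1 - k, m) = 'C(N, (n + m).+1))%N.
Proof.
elim: N m => [|N IH] m; first by rewrite big_ord0.
rewrite big_ord_recr /= subnn.
case: m => [|m].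
  rewrite bin0 muln1 addn0 binS; congr (_ + _)%N.
  have := IH 0%N; rewrite addn0 => <-.
  by apply: eq_bigr => k _; rewrite !bin0.
rewrite bin0n muln0 addn0 addnS binS.
have := IH m; have := IH m.+1; rewrite addnS => <- <-; rewrite -big_split /=.
apply: eq_bigr => k _; rewrite -mulnDr -binS; congr (_ * 'C(_, _))%N.
by have := ltn_ord k; lia.
Qed.

Lemma ffact_le_expn (k n : nat) : (k ^_ n <= k ^ n)%N.
Proof.
elim: n => [|n IH]; first by rewrite ffactn0.
by rewrite ffactnSr expnSr leq_mul // leq_subr.
Qed.

(** A quantitative form of [k ^_ n / k ^ n -> 1]: for [k > 0] the relative error is at most
    [n ^ 2 / k]. *)
Lemma expn_le_ffact (k n : nat) : (k ^ n.+1 <= k * k ^_ n + n ^ 2 * k ^ n)%N.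
Proof.
elim: n => [|n IH]; first by rewrite ffactn0 expn1 muln1 leq_addr.
(* Truncated subtraction makes this an inequality when [k < n]. *)
have kn : (k * k <= k * (k - n) + n * k)%N by nia.
have := ffact_le_expn k n; move: IH.
rewrite (expnS k n.+1) (expnS k n) ffactnSr.
move: (k ^_ n)%N (k ^ n)%N => a b h1 h2.
apply: (@leq_trans (k * (k * a + n ^ 2 * b))%N); first by rewrite leq_mul2l h1 orbT.
apply: (@leq_trans ((k * (k - n) + n * k) * a + k * (n ^ 2 * b)))%N.
  by rewrite mulnDr leq_add2r mulnA leq_mul2r kn orbT.
by nia.
Qed.

(** Convexity of [x ^ n]: a unit increment is at least the derivative at the left end. *)
Lemma expnS_sub_ge (j n : nat) : (n * j ^ n.-1 <= j.+1 ^ n - j ^ n)%N.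
Proof.
suff : (j ^ n + n * j ^ n.-1 <= j.+1 ^ n)%N by lia.
elim: n => [|n IH] //=.
rewrite (expnS j.+1 n); apply: leq_trans (leq_mul (leqnn _) IH).
case: n {IH} => [|n] /=; first by rewrite expn1 !expn0; lia.
rewrite !expnS; nia.
Qed.

(** A discrete form of the Beta integral of [n * x^n * (1 - x)^(n-1)] over [[0, 1]], which equals
    [n!^2 / (2n)!]. Termwise, powers dominate falling factorials, and [sum_bin_mul] evaluates the
    resulting sum. *)
Lemma sum_expn_ge (n N : nat) : (0 < n)%N ->
  (n`! ^ 2 * 'C(N, 2 * n) <=
   \sum_(k < N) k ^ n * ((N - k) ^ n - (N - k.+1) ^ n))%N.
Proof.
move=> n0.
have -> : (2 * n = (n + n.-1).+1)%N by lia.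
rewrite -sum_bin_mul big_distrr /=; apply: leq_sum => k _.
have kN := ltn_ord k.
rewrite -mulnn mulnACA; apply: leq_mul.
  by rewrite mulnC bin_ffact ffact_le_expn.
have -> : (N - k = (N.-1 - k).+1)%N by lia.
have -> : (N - k.+1 = N.-1 - k)%N by lia.
apply: leq_trans (expnS_sub_ge _ _).
case: n n0 => // n _ /=.
rewrite factS -mulnA leq_mul2l mulnC bin_ffact ffact_le_expn orbT //.
Qed.

(* The sum is Abel summation applied to the decreasing weights [u]: it only
   sees the first index at which [P] holds. *)
Lemma sum_decr_le (R : realType) (u : nat -> R) (P : nat -> bool) (c : R)
    (M : nat) :
  0 <= c -> 0 <= u M -> (forall k, (k < M)%N -> u k.+1 <= u k) ->
  (forall k, (k < M)%N -> P k -> u k <= c) ->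
  \sum_(k < M) (u k - u k.+1) * (P k)%:R <= c.
Proof.
move=> c0; elim: M u P => [|M IH] u P uM u_decr uc; first by rewrite big_ord0.
case: (boolP (P 0%N)) => [P0|/negbTE P0].
  apply: le_trans (uc 0%N _ P0) => //.
  apply: (@le_trans _ _ (\sum_(0 <= k < M.+1) (u k - u k.+1))).
    rewrite big_mkord; apply: ler_sum => k _.
    by rewrite ler_piMr ?subr_ge0 ?u_decr // lern1 leq_b1.
  under eq_bigr do rewrite -opprB.
  by rewrite sumrN telescope_sumr // opprB gerBl.
rewrite big_ord_recl P0 mulr0 add0r.
by apply: (IH (u \o succn) (P \o succn)) => // k;
  [exact: (u_decr k.+1)|exact: (uc k.+1)].
Qed.

(** The sums are bounded below by quantities tending to [n!^2 / (2n)!], the inverse of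
    ['C(2 * n, n)]. *)
Lemma rogers_shephard_limit (R : realType) (n : nat) (X Y : R) : (0 < n)%N ->
  0 <= Y ->
  (forall N, (0 < N)%N -> Y * \sum_(k < N) (k%:R / N%:R) ^+ n *
    ((1 - k%:R / N%:R) ^+ n - (1 - k.+1%:R / N%:R) ^+ n) <= X) ->
  Y <= 'C(2 * n, n)%:R * X.
Proof.
move=> n0 Y0 H.
have F0 : 0 < (n`!)%:R ^+ 2 :> R by rewrite exprn_gt0 // ltr0n fact_gt0.
have F20 : 0 < ((2 * n)`!)%:R :> R by rewrite ltr0n fact_gt0.
have CE : 'C(2 * n, n)%:R * (n`!)%:R ^+ 2 = ((2 * n)`!)%:R :> R.
  rewrite -natrX -natrM; congr (_%:R).
  rewrite -(@bin_fact (2 * n) n) ?leq_pmull //.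
  by rewrite (_ : (2 * n - n)%N = n) ?mulnn //; lia.
(* The limit in explicit form: [sum_expn_ge] bounds the sum below by [n!^2 / (2n)!] times
   [N ^_ (2 * n) / N ^ (2 * n)], and [expn_le_ffact] puts that ratio within [(2 * n) ^ 2 / N] of
   [1]. *)
have bound N : (0 < N)%N -> N%:R * (Y * (n`!)%:R ^+ 2 - X * ((2 * n)`!)%:R) <=
    Y * (n`!)%:R ^+ 2 * ((2 * n) ^ 2)%:R.
  move=> N0; have N0' : 0 < N%:R :> R by rewrite ltr0n.
  have NE (k : 'I_N) : (k%:R / N%:R) ^+ n *
      ((1 - k%:R / N%:R) ^+ n - (1 - k.+1%:R / N%:R) ^+ n) =
      N%:R^-1 ^+ (2 * n) * (k ^ n * ((N - k) ^ n - (N - k.+1) ^ n))%N%:R :> R.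
    have kN := ltn_ord k.
    have E j : (j <= N)%N -> 1 - j%:R / N%:R = (N - j)%N%:R * N%:R^-1 :> R.
      by move=> jN; rewrite natrB // mulrBl mulfV ?gt_eqF.
    rewrite !E // 1?ltnW // !exprMn natrM [in RHS]natrB;
      last by rewrite leq_exp2r //; lia.
    by rewrite !natrX mulrC mul2n -addnn exprD; ring.
  have {}H := H N N0.
  rewrite (eq_bigr _ (fun k _ => NE k)) -big_distrr /= -natr_sum in H.
  have S := sum_expn_ge N n0.
  set s := (\sum_(k < N) _)%N in S H.
  have {}H : Y * (n`! ^ 2 * 'C(N, 2 * n))%:R <= X * N%:R ^+ (2 * n).
    apply: (@le_trans _ _ (Y * s%:R)); first by rewrite ler_wpM2l // ler_nat.
    have NN0 : 0 < N%:R ^+ (2 * n) :> R by rewrite exprn_gt0.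
    rewrite -ler_pdivrMr //; apply: le_trans H.
    by rewrite -exprVn -mulrA [s%:R * _]mulrC.
  have {}H : Y * (n`!)%:R ^+ 2 * (N ^_ (2 * n))%:R <=
      X * ((2 * n)`!)%:R * N%:R ^+ (2 * n).
    have := ler_wpM2r (ltW F20) H.
    rewrite -bin_ffact !natrM.
    by move: (n`!)%:R ('C(N, _))%:R ((2 * n)`!)%:R (N%:R ^+ _) => *; lra.
  have G : N%:R ^+ (2 * n) * N%:R <=
      N%:R * (N ^_ (2 * n))%:R + ((2 * n) ^ 2)%:R * N%:R ^+ (2 * n) :> R.
    have := expn_le_ffact N (2 * n).
    by rewrite -(ler_nat R) natrD !natrM !natrX exprSr.
  have NN0 : 0 < N%:R ^+ (2 * n) :> R by rewrite exprn_gt0.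
  rewrite -(ler_pM2r NN0) mulrBr mulrBl lerBlDr.
  set p := N%:R ^+ (2 * n) in H G NN0 *; set q := (N ^_ _)%:R in H G.
  set y := Y * _ in H *; set x := X * _ in H *.
  have y0 : 0 <= y by rewrite mulr_ge0 // ltW.
  have h1 := ler_wpM2l y0 G; have h2 := ler_wpM2l (ltW N0') H; nra.
suff : Y * (n`!)%:R ^+ 2 <= X * ((2 * n)`!)%:R.
  by rewrite -CE mulrA ler_pM2r // mulrC.
(* A positive gap [d] would make [N * d] bounded uniformly in [N > 0], against the Archimedean
   property. *)
rewrite leNgt; apply/negP => lt.
set d := Y * _ - X * _ in bound.
have d0 : 0 < d by rewrite subr_gt0.
set z := Y * _ * _ in bound.
have z0 : 0 <= z / d by rewrite divr_ge0 ?(ltW d0) // /z !mulr_ge0 // ltW.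
have := bound _ (ltn0Sn (Num.bound (z / d))).
apply/negP; rewrite -ltNge -ltr_pdivrMr //.
by apply: lt_trans (archi_boundP z0) _; rewrite ltr_nat.
Qed.

(** * Convolution of convex sets and the Rogers-Shephard inequality *)

Section rogers_shephard.
Context {R : realType} {n : nat}.
Implicit Types (A B D : set 'rV[R]_n).

(** The weight is a plain real number; [convex_set_convex] links this to [convex_set]. *)
Definition convex A : Prop := forall (x y : 'rV[R]_n) (t : R), A x -> A y ->
  0 <= t <= 1 -> A ((1 - t) *: x + t *: y).

Let conv_set A B : set (coords R n * coords R n) :=
  [set p | A (row_of_coords p.2) /\ B (row_of_coords p.1 - row_of_coords p.2)].

Let measurable_conv_set A B : vol_measurable A -> vol_measurable B ->
  measurable (conv_set A B).
Proof.
move=> mA mB.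
rewrite (_ : conv_set A B =
    (snd @^-1` (@row_of_coords R n @^-1` A)) `&`
    ((fun p => coords_add_scale (-1) p.1 p.2) @^-1` (@row_of_coords R n @^-1` B))).
  apply: measurableI; apply: measurable_preimageT => //.
  exact: measurable_coords_add_scale.
by apply/seteqP; split=> -[x y] [/= Ay Bxy]; split => //=; move: Bxy;
  rewrite row_of_coords_add_scale scaleN1r.
Qed.

Let xsection_conv_set A B x : lebesgue_coords R n (xsection (conv_set A B) x) =
  vol [set y | A y /\ B (row_of_coords x - y)].
Proof. by rewrite /vol xsectionE. Qed.

(** Tonelli on [conv_set A B]: the section at [y] is the translate [y + B] when [y] is in [A] and
    empty otherwise. *)
Lemma integral_vol_convolution A B : vol_measurable A -> vol_measurable B ->
  (\int[lebesgue_coords R n]_x vol [set y | A y /\ B (row_of_coords x - y)%R] =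
   vol A * vol B)%E.
Proof.
move=> mA mB; pose mu := lebesgue_coords R n.
have mE := measurable_conv_set mA mB.
transitivity (\int[mu]_x (mu \o xsection (conv_set A B)) x)%E.
  by apply: eq_integral => x _; rewrite /= xsection_conv_set.
rewrite -(indic_fubini_tonelli_FE mu mE) (indic_fubini_tonelli mu mu mE).
rewrite indic_fubini_tonelli_GE //.
transitivity (\int[mu]_y ((\1_(@row_of_coords R n @^-1` A) y)%:E * vol B))%E.
  apply: eq_integral => y _ /=; rewrite ysectionE indicE.
  have [yA|yA] := boolP (y \in _).
    have VB := @vol_affine R n 1 (- row_of_coords y) B ltr01 mB.
    rewrite mul1e -[RHS]mul1e -[X in (X%:E * _)%E](expr1n _ n).
    rewrite -[X in ((X ^+ n)%:E * _)%E]invr1 -VB.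
    rewrite /vol; congr (lebesgue_coords _ _ _).
    apply/seteqP; split=> x; rewrite /preimage /conv_set /= scale1r addrC.
      by case.
    by move=> Bx; split => //; move: yA; rewrite inE.
  rewrite mul0e (_ : _ @^-1` _ = set0) ?measure0 //.
  by apply/seteqP; split=> // x [/= Ay _]; move: yA; rewrite notin_setE => /(_ Ay).
rewrite ge0_integralZr ?vol_ge0 //.
  by rewrite (integral_indic _ measurableT mA) setIT.
exact/measurable_EFinP/measurable_indic/mA.
Qed.

Lemma measurable_vol_convolution A B : vol_measurable A -> vol_measurable B ->
  measurable_fun [set: coords R n]
    (fun x => vol [set y | A y /\ B (row_of_coords x - y)]).
Proof.
move=> mA mB.
rewrite (_ : (fun x => _) = lebesgue_coords R n \o xsection (conv_set A B)).
  by apply: measurable_fun_xsection; exact: measurable_conv_set.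
by apply/funext => x /=; rewrite xsection_conv_set.
Qed.

Lemma vol_measurable_section A B x : vol_measurable A -> vol_measurable B ->
  vol_measurable [set y | A y /\ B (x - y)].
Proof.
move=> mA mB; have [s <-] := row_of_coords_surj x.
have := measurable_xsection s (measurable_conv_set mA mB).
by rewrite xsectionE.
Qed.

(* If [d = a + b] then [(1 - t) *: y + t *: a] stays in the section above
   [t *: d] for every [y] in the section above [0]. *)
Lemma vol_section_ge A B (d : 'rV[R]_n) (t : R) :
  convex A -> convex B -> vol_measurable A -> vol_measurable B ->
  minkowski_sum A B d -> 0 <= t < 1 ->
  (((1 - t) ^+ n)%:E * vol [set y | A y /\ B (0 - y)%R] <=
   vol [set y | A y /\ B (t *: d - y)%R])%E.
Proof.
move=> cA cB mA mB [a Aa [b Bb <-]] /andP[t0 t1].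
have t1' : 0 < 1 - t by rewrite subr_gt0.
have ti0 : 0 < (1 - t)^-1 by rewrite invr_gt0.
have mS := vol_measurable_section 0 mA mB.
(* This is the inverse of [y |-> (1 - t) *: y + t *: a]; its factor [(1 - t)^-1] produces
   [(1 - t) ^+ n]. *)
have := vol_affine (- ((1 - t)^-1 * t) *: a) ti0 mS; rewrite invrK => <-.
apply: le_vol; [exact: vol_measurable_affine|exact: vol_measurable_section|].
move=> y /=; set y' := _ + _; rewrite sub0r => -[Ay' By'].
have yE : y = (1 - t) *: y' + t *: a.
  rewrite /y' scalerDr !scalerA mulrN mulrA mulfV ?gt_eqF // mul1r scale1r.
  by rewrite scaleNr addrAC addNr add0r.
have t01 : 0 <= t <= 1 by rewrite t0 ltW.
split; first by rewrite yE; exact: cA.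
(* The [t *: a] terms cancel: [t *: d - y = (1 - t) *: (- y') + t *: b]. *)
rewrite yE scalerDr [t *: a + _]addrC opprD addrACA subrr addr0 addrC -scalerN.
exact: cB.
Qed.

Lemma rogers_shephard A B D : (0 < n)%N ->
  convex A -> convex B -> vol_measurable A -> vol_measurable B ->
  vol_measurable D -> D `<=` minkowski_sum A B ->
  (vol A < +oo)%E -> (vol B < +oo)%E -> (vol D < +oo)%E ->
  fine (vol D) * fine (vol [set y | A y /\ B (- y)]) <=
  'C(2 * n, n)%:R * (fine (vol A) * fine (vol B)).
Proof.
move=> n0 cA cB mA mB mD DAB Aoo Boo Doo.
pose f x := vol [set y | A y /\ B (x - y)].
have foo x : f x \is a fin_num.
  rewrite ge0_fin_numE ?vol_ge0 //; apply: le_lt_trans Aoo.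
  by apply: le_vol => //; [exact: vol_measurable_section|move=> y []].
have f0E : [set y | A y /\ B (- y)] = [set y | A y /\ B (0 - y)].
  by apply/seteqP; split=> y /=; rewrite sub0r.
rewrite f0E -/(f 0); set f0 := fine (f 0).
have f00 : 0 <= f0 by rewrite fine_ge0 // vol_ge0.
have [vAfin vBfin vDfin] : [/\ vol A \is a fin_num, vol B \is a fin_num &
    vol D \is a fin_num] by rewrite !ge0_fin_numE ?vol_ge0.
have vD0 : 0 <= fine (vol D) by rewrite fine_ge0 // vol_ge0.
apply: rogers_shephard_limit => // [|[//|M] _]; first by rewrite mulr_ge0.
(* The index is shifted by one so that every dilation factor is positive and invertible; the term at
   [0] of the target sum vanishes anyway. *)
pose t (k : nat) : R := k.+1%:R / M.+1%:R.
pose u (k : nat) : R := (1 - t k) ^+ n * f0.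
have t0 k : 0 < t k by rewrite divr_gt0.
have tM k : (k < M)%N -> t k < 1 by move=> kM; rewrite ltr_pdivrMr // mul1r ltr_nat.
have uM : u M = 0 by rewrite /u /t divff // subrr expr0n gtn_eqF // mul0r.
pose Dk (k : nat) : set 'rV[R]_n := [set x | D (0 + (t k)^-1 *: x)].
have mDk k : vol_measurable (Dk k) by exact: vol_measurable_affine.
have vDk k : vol (Dk k) = ((t k) ^+ n * fine (vol D))%:E.
  by rewrite vol_affine ?invr_gt0 // invrK EFinM fineK.
pose g (x : coords R n) : R :=
  \sum_(k < M) (u k - u k.+1) * \1_(@row_of_coords R n @^-1` Dk k) x.
have u_decr k : (k < M)%N -> u k.+1 <= u k.
  move=> kM; rewrite ler_wpM2r //; apply: lerXn2r.
  - by rewrite nnegrE subr_ge0 ler_pdivrMr // mul1r ler_nat.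
  - by rewrite nnegrE subr_ge0; exact/ltW/tM.
  - by rewrite lerD2l lerN2 ler_pM2r ?invr_gt0 // ler_nat.
have uk0 k : (k < M)%N -> 0 <= u k - u k.+1 by move=> kM; rewrite subr_ge0 u_decr.
(* A point of [Dk k] is [t k *: d] with [d] in [D], so [vol_section_ge] gives [u k <= f];
   [sum_decr_le] combines these bounds without requiring the dilates to be nested. *)
have g_le_f x : g x <= fine (f (row_of_coords x)).
  rewrite /g; under eq_bigr do rewrite indicE.
  apply: (@sum_decr_le R u (fun k => x \in (@row_of_coords R n @^-1` Dk k))) => //.
  - by rewrite fine_ge0 // vol_ge0.
  - by rewrite uM.
  move=> k kM /[!inE] Dx.
  rewrite -lee_fin fineK // /u EFinM /f0 fineK //.
  have := vol_section_ge cA cB mA mB (DAB _ Dx) (t := t k).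
  rewrite (ltW (t0 k)) tM // => /(_ isT).
  by rewrite /f add0r scalerA mulfV ?gt_eqF // scale1r.
have int_g : (\int[lebesgue_coords R n]_x (g x)%:E =
    (\sum_(k < M) (u k - u k.+1) * ((t k) ^+ n * fine (vol D)))%:E)%E.
  under eq_integral do rewrite /g -sumEFin.
  rewrite ge0_integral_sum //; last 2 first.
  - move=> k; apply/measurable_EFinP/measurable_funM; first exact: measurable_cst.
    exact/measurable_indic/mDk.
  - by move=> k x _; rewrite lee_fin mulr_ge0 ?uk0.
  rewrite -sumEFin; apply: eq_bigr => k _.
  rewrite (integralZl_indic measurableT (fun=> @row_of_coords R n @^-1` Dk k)) //.
  - by rewrite (integral_indic _ measurableT (mDk k)) setIT EFinM -vDk.
  - by rewrite ltNge uk0.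
  - exact: mDk.
have int_le : (\int[lebesgue_coords R n]_x (g x)%:E <= vol A * vol B)%E.
  rewrite -integral_vol_convolution //; apply: ge0_le_integral => //.
  - move=> x _; rewrite lee_fin sumr_ge0 // => k _.
    by rewrite mulr_ge0 ?uk0 // indicE.
  - apply/measurable_EFinP; apply: measurable_sum => k.
    apply: measurable_funM; first exact: measurable_cst.
    exact/measurable_indic/mDk.
  - exact: measurable_vol_convolution.
  - move=> x _; rewrite -[leRHS](fineK (foo (row_of_coords x))) lee_fin.
    exact: g_le_f.
move: int_le; rewrite int_g -(fineK vAfin) -(fineK vBfin) -EFinM lee_fin.
(* The first summand contains [0 ^+ n = 0]; the others match those of the integral after the
   shift. *)
apply: le_trans; rewrite big_ord_recl mul0r expr0n gtn_eqF // mul0r add0r.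
rewrite mulr_sumr; apply: ler_sum => k _.
rewrite lift0 -/(t k) -/(t k.+1) /u -mulrBl le_eqVlt.
by apply/orP; left; apply/eqP; ring.
Qed.

End rogers_shephard.

(** * Minkowski sums, cubes and reflections *)

Lemma convex_set_convex (R : realType) (n : nat) (K : set 'rV[R]_n) :
  convex_set K -> convex K.
Proof.
move=> cK x y t Kx Ky /andP[t0 t1].
(* The first point carries the weight [t], hence the swap of [x] and [y]. *)
have := cK y x (Itv01 t0 t1); rewrite !inE => /(_ Ky Kx).
by rewrite addrC.
Qed.

Section minkowski.
Context {R : realType} {n : nat}.
Implicit Types (K L M : set 'rV[R]_n).

Lemma coord_bounded_set K : bounded_set K -> coord_bounded K.
Proof.
move=> [B [_ KB]]; exists (B + 1) => x Kx i.
(* [bounded_set] only provides bounds strictly above [B]. *)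
have := KB (B + 1); rewrite ltrDl ltr01 => /(_ isT x Kx) /=.
apply: le_trans; rewrite [leRHS]/Num.Def.normr /= mx_normrE.
by apply/bigmax_geP; right => /=; exists (ord0, i).
Qed.

Lemma coord_bounded_minkowski K L :
  coord_bounded K -> coord_bounded L -> coord_bounded (minkowski_sum K L).
Proof.
move=> [B KB] [C LC]; exists (B + C) => _ [k Kk [l Ll <-]] i.
by rewrite mxE (le_trans (ler_normD _ _)) // lerD ?KB ?LC.
Qed.

Lemma coord_bounded_open_cube (r : R) : coord_bounded (@open_cube R n r).
Proof. by exists r => x xr i; rewrite ltW // ltr_norml; exact: xr. Qed.

Lemma coord_bounded_opp K : coord_bounded K -> coord_bounded (set_opp K).
Proof. by move=> [B KB]; exists B => _ [k Kk <-] i; rewrite mxE normrN KB. Qed.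

Lemma convex_minkowski K L : convex K -> convex L -> convex (minkowski_sum K L).
Proof.
move=> cK cL _ _ t [a Ka [b Lb <-]] [c Kc [d Ld <-]] t01.
exists ((1 - t) *: a + t *: c); first exact: cK.
exists ((1 - t) *: b + t *: d); first exact: cL.
by rewrite !scalerDr addrACA.
Qed.

Lemma convex_opp K : convex K -> convex (set_opp K).
Proof.
move=> cK _ _ t [a Ka <-] [b Kb <-] t01.
by exists ((1 - t) *: a + t *: b); [exact: cK|rewrite !scalerN opprD].
Qed.

Lemma convex_open_cube (r : R) : convex (@open_cube R n r).
Proof.
move=> x y t xr yr /andP[t0 t1] i; rewrite !mxE.
have /andP[x1 x2] := xr i; have /andP[y1 y2] := yr i.
have t1' : 0 <= 1 - t by rewrite subr_ge0.
have [xy|/ltW xy] := leP (x 0 i) (y 0 i).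
  have := mulr_ge0 t0 (_ : 0 <= y 0 i - x 0 i).
  have := mulr_ge0 t1' (_ : 0 <= y 0 i - x 0 i).
  by rewrite subr_ge0 => /(_ xy) ? /(_ xy) ?; apply/andP; split; lra.
have := mulr_ge0 t0 (_ : 0 <= x 0 i - y 0 i).
have := mulr_ge0 t1' (_ : 0 <= x 0 i - y 0 i).
by rewrite subr_ge0 => /(_ xy) ? /(_ xy) ?; apply/andP; split; lra.
Qed.

Lemma minkowski_cubeP K (r : R) x :
  minkowski_sum K (open_cube r) x <-> exists2 k, K k & sup_ball k r x.
Proof.
split=> [[k Kk [c cr <-]]|[k Kk kx]].
  exists k => // i; rewrite mxE addrAC subrr add0r ltr_norml; exact: cr.
exists k => //; exists (x - k); last by rewrite addrC subrK.
by move=> i; rewrite -ltr_norml !mxE; exact: kx.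
Qed.

Lemma sup_open_minkowski_cube K (r : R) :
  sup_open (minkowski_sum K (open_cube r)).
Proof.
move=> x /minkowski_cubeP[k Kk kx].
(* The least slack over the coordinates; the default [1] keeps the minimum positive. *)
pose e := \big[Order.min/1]_i (r - `|x 0 i - k 0 i|).
exists e; first by apply: lt_bigmin => // i _; rewrite subr_gt0; exact: kx.
move=> y xy; apply/minkowski_cubeP; exists k => // i.
rewrite -(subrKA (x 0 i)); apply: le_lt_trans (ler_normD _ _) _.
by rewrite -ltrBrDr; apply: lt_le_trans (xy i) _; exact: bigmin_le_cond.
Qed.

Lemma vol_measurable_minkowski_cube K (r : R) :
  vol_measurable (minkowski_sum K (open_cube r)).
Proof. exact/vol_measurable_sup_open/sup_open_minkowski_cube. Qed.

(** Scaling by [(2 * e)^-1] about [x] carries the ball to the open unit cell at the origin. *)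
Lemma vol_sup_ball (x : 'rV[R]_n) (e : R) : 0 < e ->
  vol (sup_ball x e) = ((2 * e) ^+ n)%:E.
Proof.
move=> e0; have e20 : 0 < (2 * e)^-1 by rewrite invr_gt0 mulr_gt0.
have mC := @vol_measurable_lattice_cell R n false 0.
have := vol_affine (- (2 * e)^-1 *: x) e20 mC.
rewrite vol_lattice_cell invrK mule1 => <-; congr vol.
have ballE y i : (`|y 0 i - x 0 i| < e) =
    (`|- (2 * e)^-1 * x 0 i + (2 * e)^-1 * y 0 i| < 1 / 2).
  rewrite mulNr [in RHS]addrC -mulrBr normrM gtr0_norm // mulrC.
  rewrite ltr_pdivrMr ?mulr_gt0 // mulrA.
  by rewrite (_ : 1 / 2 * 2 = 1) ?mul1r //; lra.
by apply/seteqP; split=> y H i; have := H i;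
  rewrite /= in_itv /= !mxE subr0 -ltr_norml ballE.
Qed.

Lemma vol_lty M : coord_bounded M -> vol_measurable M -> (vol M < +oo)%E.
Proof.
(* [B] may be negative when [M] is empty, so the radius uses its absolute value. *)
move=> [B MB] mM; have b0 : 0 < `|B| + 1 by rewrite ltr_wpDl.
apply: le_lt_trans (ltry ((2 * (`|B| + 1)) ^+ n)).
rewrite -(vol_sup_ball 0 b0); apply: le_vol => //.
  exact: vol_measurable_sup_ball.
move=> x Mx i; rewrite mxE subr0; apply: le_lt_trans (MB x Mx i) _.
by rewrite (le_lt_trans (ler_norm B)) // ltrDl.
Qed.

Lemma set_oppK M : set_opp (set_opp M) = M.
Proof.
apply/seteqP; split=> [_ [_ [x Mx <-] <-]|x Mx]; first by rewrite opprK.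
by exists (- x); [exists x|rewrite opprK].
Qed.

(** The cube is symmetric; the second inclusion is the first one applied to [set_opp K]. *)
Lemma minkowski_opp_cube K (r : R) :
  minkowski_sum (set_opp K) (open_cube r) =
  set_opp (minkowski_sum K (open_cube r)).
Proof.
have sub L : minkowski_sum (set_opp L) (open_cube r) `<=`
    set_opp (minkowski_sum L (open_cube r)).
  move=> x /minkowski_cubeP[_ [k Lk <-] kx]; exists (- x); last exact: opprK.
  apply/minkowski_cubeP; exists k => // i.
  by have := kx i; rewrite !mxE opprK -normrN opprD.
apply/seteqP; split; first exact: sub.
move=> _ [x Kx <-]; rewrite -[K]set_oppK in Kx.
by have [y yK <-] := sub _ _ Kx; rewrite opprK.
Qed.

Lemma lattice_count_opp M : coord_bounded M ->
  lattice_count (set_opp M) = lattice_count M.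
Proof.
move=> bM; rewrite /lattice_count.
have -> : set_opp M `&` @integer_lattice R n =
    -%R @` (M `&` @integer_lattice R n).
  apply/seteqP; split=> [_ [[x Mx <-] Zx]|_ [x [Mx Zx] <-]].
    by exists x => //; split=> // i; have := Zx i; rewrite mxE rpredN.
  by split; [exists x|move=> i; rewrite mxE rpredN].
rewrite fset_set_image; last exact: finite_lattice.
by rewrite card_imfset //; exact: oppr_inj.
Qed.

End minkowski.

(** * The volume ratio and the lattice point inequality *)

Section volume_ratio.
Context {R : realType} {n : nat}.
Implicit Types (K L M : set 'rV[R]_n).
Hypothesis n_gt0 : (0 < n)%N.

(* A ball of radius 1/8 around [m + (7/8) e_i], with the i-th coordinate of [m]
   nearly maximal, lies in the larger parallel set and misses the smaller. *)
Lemma vol_parallel_lt M : M !=set0 -> coord_bounded M ->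
  0 < fine (vol (minkowski_sum M (open_cube (1 / 2)))) <
  fine (vol (minkowski_sum M (open_cube 1))).
Proof.
move=> [m0 Mm0] bM; pose i0 := Ordinal n_gt0.
set A := minkowski_sum M _; set B := minkowski_sum M _.
have mA : vol_measurable A by exact: vol_measurable_minkowski_cube.
have mB : vol_measurable B by exact: vol_measurable_minkowski_cube.
have Aoo : vol A \is a fin_num.
  rewrite ge0_fin_numE ?vol_ge0 // vol_lty //.
  exact/coord_bounded_minkowski/coord_bounded_open_cube.
have Boo : vol B \is a fin_num.
  rewrite ge0_fin_numE ?vol_ge0 // vol_lty //.
  exact/coord_bounded_minkowski/coord_bounded_open_cube.
apply/andP; split.
  rewrite -lte_fin fineK //.
  apply: (@lt_le_trans _ _ (vol (sup_ball m0 (1 / 2)))).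
    by rewrite vol_sup_ball ?lte_fin ?exprn_gt0 ?mulr_gt0.
  apply: le_vol => //; first exact: vol_measurable_sup_ball.
  by move=> x xm; apply/minkowski_cubeP; exists m0.
pose S := [set m 0 i0 | m in M].
have supS : has_sup S.
  split; first by exists (m0 0 i0), m0.
  have [b Mb] := bM; exists b => _ [m Mm <-].
  exact: le_trans (ler_norm _) (Mb m Mm i0).
(* With [1/4] here, the [i0]-coordinates of the ball exceed [m 0 i0 + 7/8 - 1/8 > sup S + 1/2], yet
   stay below [m 0 i0 + 1]. *)
have [_ [m Mm <-] ms] := @sup_adherent R S (1 / 4) ltac:(lra) supS.
pose p : 'rV[R]_n := m + (7 / 8) *: delta_mx 0 i0.
have mp : vol_measurable (sup_ball p (1 / 8)) by exact: vol_measurable_sup_ball.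
rewrite -lte_fin !fineK //.
apply: (@lt_le_trans _ _ (vol (A `|` sup_ball p (1 / 8)))); last first.
  apply: le_vol => //.
    by rewrite /vol_measurable preimage_setU; exact: measurableU.
  move=> x [/minkowski_cubeP[k Kk kx]|px]; apply/minkowski_cubeP.
    by exists k => // i; apply: lt_trans (kx i) _; lra.
  exists m => // i; have := px i; rewrite !mxE eqxx /=.
  case: (i == i0); rewrite /= ?mulr1 ?mulr0 !ltr_norml => /andP[? ?];
    by apply/andP; split; lra.
have -> : vol (A `|` sup_ball p (1 / 8)) = (vol A + vol (sup_ball p (1 / 8)))%E.
  rewrite /vol preimage_setU; apply: measureU; [exact: mA|exact: mp|].
  apply/seteqP; split=> // x [/= /minkowski_cubeP[k Mk kx] xp].
  have := kx i0; have := xp i0; rewrite !mxE !eqxx /= !ltr_norml.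
  have : k 0 i0 <= sup S by apply: ub_le_sup; [exact: supS.2|exists k].
  by move=> ? /andP[? ?] /andP[? ?]; lra.
by rewrite vol_sup_ball // lteDl // lte_fin exprn_gt0 ?mulr_gt0.
Qed.

Lemma cube_vol_ratio_itv K L : K !=set0 -> coord_bounded K ->
  L !=set0 -> coord_bounded L -> 0 < cube_vol_ratio K L < 1.
Proof.
move=> [k Kk] bK [l Ll] bL.
have /andP[W0 WV] := @vol_parallel_lt (minkowski_sum K L)
  (ex_intro _ _ (ex_intro2 _ _ k Kk (ex_intro2 _ _ l Ll erefl)))
  (coord_bounded_minkowski bK bL).
have V0 := lt_trans W0 WV.
apply/andP; split; first exact: divr_gt0.
by rewrite /cube_vol_ratio ltr_pdivrMr // [ltRHS]mul1r.
Qed.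

Lemma lattice_rogers_shephard K L : K !=set0 -> convex K -> coord_bounded K ->
  L !=set0 -> convex L -> coord_bounded L ->
  (lattice_count (minkowski_sum K L))%:R * (lattice_count (K `&` set_opp L))%:R
  <= 'C(2 * n, n)%:R * cube_vol_ratio K L
     * (lattice_count (minkowski_sum K (open_cube 1)))%:R
     * (lattice_count (minkowski_sum L (open_cube 1)))%:R.
Proof.
move=> K0 cK bK L0 cL bL.
have bKL := coord_bounded_minkowski bK bL.
have bcube M r : coord_bounded M ->
    coord_bounded (minkowski_sum M (@open_cube R n r)).
  by move=> bM; apply: coord_bounded_minkowski bM (@coord_bounded_open_cube R n r).
have mcube M r : vol_measurable (minkowski_sum M (@open_cube R n r)).
  exact: vol_measurable_minkowski_cube.
have fcube M r : coord_bounded M ->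
    vol (minkowski_sum M (@open_cube R n r)) \is a fin_num.
  by move=> bM; rewrite ge0_fin_numE ?vol_ge0 // vol_lty //; exact: bcube.
have count_le M : coord_bounded M -> (lattice_count M)%:R <=
    fine (vol (minkowski_sum M (open_cube (1 / 2)))).
  move=> bM; rewrite -lee_fin fineK ?fcube //.
  apply: lattice_count_le_vol => // z Mz x xz; apply/minkowski_cubeP.
  by exists z.
have le_count M : coord_bounded M ->
    fine (vol (minkowski_sum M (open_cube (1 / 2)))) <=
    (lattice_count (minkowski_sum M (open_cube 1)))%:R.
  move=> bM; rewrite -lee_fin fineK ?fcube //.
  apply: vol_le_lattice_count => // [|x z /minkowski_cubeP[m Mm mx] xz].
    exact: bcube.
  (* A strict and a non-strict distance [1/2] add up to less than [1], so the open cube suffices. *)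
  apply/minkowski_cubeP; exists m => // i.
  have := mx i; have := xz i; rewrite !ler_norml !ltr_norml.
  by move=> /andP[? ?] /andP[? ?]; apply/andP; split; lra.
have /andP[c0 _] := cube_vol_ratio_itv K0 bK L0 bL.
set A := minkowski_sum K (open_cube (1 / 2)).
set B := minkowski_sum L (open_cube (1 / 2)).
have mAB : vol_measurable [set y | A y /\ B (- y)].
  have := @vol_measurable_section R n A B 0 (mcube _ _) (mcube _ _).
  by congr vol_measurable; apply/seteqP; split=> y /=; rewrite sub0r.
have ABfin : vol [set y | A y /\ B (- y)] \is a fin_num.
  rewrite ge0_fin_numE ?vol_ge0 //; apply: vol_lty => //.
  by have [b Ab] := bcube _ (1 / 2) bK; exists b => y [Ay _]; exact: Ab.
have count_cap : (lattice_count (K `&` set_opp L))%:R <=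
    fine (vol [set y | A y /\ B (- y)]).
  rewrite -lee_fin fineK //; apply: lattice_count_le_vol => //.
    by have [b Kb] := bK; exists b => y [Ky _]; exact: Kb.
  move=> z [Kz [l Ll lz]] y yz; split; apply/minkowski_cubeP.
    by exists z.
  exists l => // i; have := yz i; rewrite -lz !mxE opprK -normrN opprD.
  by rewrite addrC.
have RS : fine (vol (minkowski_sum (minkowski_sum K L) (open_cube 1))) *
    fine (vol [set y | A y /\ B (- y)]) <=
    'C(2 * n, n)%:R * (fine (vol A) * fine (vol B)).
  apply: rogers_shephard => //; do ?[exact: mcube];
    do ?[by rewrite -ge0_fin_numE ?vol_ge0 ?fcube].
  - exact: convex_minkowski cK (@convex_open_cube R n _).
  - exact: convex_minkowski cL (@convex_open_cube R n _).
  move=> _ [_ [k Kk [l Ll <-]] [c cc <-]].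
  (* Halving [c] shares the unit cube between [A] and [B]. *)
  have hc : @open_cube R n (1 / 2) ((1 / 2) *: c).
    by move=> i; have /andP[? ?] := cc i; rewrite mxE; apply/andP; split; lra.
  exists (k + (1 / 2) *: c); first by exists k => //; exists ((1 / 2) *: c).
  exists (l + (1 / 2) *: c); first by exists l => //; exists ((1 / 2) *: c).
  rewrite addrACA -scalerDl; congr (_ + _).
  by rewrite (_ : 1 / 2 + 1 / 2 = 1) ?scale1r //; lra.
have V0 : 0 < fine (vol (minkowski_sum (minkowski_sum K L) (open_cube 1))).
  have [[k Kk] [l Ll]] := (K0, L0).
  have /andP[W0 WV] := @vol_parallel_lt (minkowski_sum K L)
    (ex_intro _ _ (ex_intro2 _ _ k Kk (ex_intro2 _ _ l Ll erefl))) bKL.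
  exact: lt_trans WV.
have WE : fine (vol (minkowski_sum (minkowski_sum K L) (open_cube (1 / 2)))) =
    cube_vol_ratio K L *
    fine (vol (minkowski_sum (minkowski_sum K L) (open_cube 1))).
  by rewrite /cube_vol_ratio divfK // gt_eqF.
have count_prod := ler_pM (ler0n R _) (ler0n R _) (count_le _ bKL) count_cap.
apply: le_trans count_prod _.
(* Writing the smaller volume as [c] times the larger one lets [c] cancel, which leaves [RS]
   followed by [le_count] for [K] and [L]. *)
rewrite WE; move: (cube_vol_ratio K L) c0 => c c0.
rewrite -!mulrA [leRHS]mulrCA ler_pM2l //; apply: le_trans RS _.
by rewrite ler_wpM2l // ler_pM ?fine_ge0 ?vol_ge0 ?le_count.
Qed.

End volume_ratio.

Theorem theorem1p2 (R : realType) (n : nat) (n_ge1 : (1 <= n)%N) :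
  (forall K L : set 'rV[R]_n,
     K !=set0 -> convex_set K -> bounded_set K ->
     L !=set0 -> convex_set L -> bounded_set L ->
     0 < cube_vol_ratio K L < 1 /\
     (lattice_count (minkowski_sum K L))%:R
       * (lattice_count (K `&` set_opp L))%:R
     <= ('C(2 * n, n))%:R * cube_vol_ratio K L
        * (lattice_count (minkowski_sum K (open_cube 1)))%:R
        * (lattice_count (minkowski_sum L (open_cube 1)))%:R)
  /\
  (forall K : set 'rV[R]_n,
     K !=set0 -> convex_set K -> bounded_set K -> 0 \in K ->
     (lattice_count (minkowski_sum K (set_opp K)))%:R
     <= ('C(2 * n, n))%:R * cube_vol_ratio K (set_opp K)
        * ((lattice_count (minkowski_sum K (open_cube 1)))%:R ^+ 2
           / (lattice_count K)%:R)).
Proof.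
split=> [K L K0 cK bK L0 cL bL|K K0 cK bK].
  split; first by apply: cube_vol_ratio_itv => //; exact: coord_bounded_set.
  by apply: lattice_rogers_shephard => //;
    do ?[exact: convex_set_convex|exact: coord_bounded_set].
rewrite inE => K00; have {}bK := coord_bounded_set bK.
have {}cK := convex_set_convex cK.
(* The origin is a lattice point of [K], so the final division is by a positive number. *)
have GK0 : 0 < (lattice_count K)%:R :> R.
  rewrite ltr0n cardfs_gt0; apply/fset0Pn; exists 0.
  rewrite in_fset_set ?inE; last exact: finite_lattice.
  by split=> // i; rewrite mxE rpred0.
have oK0 : set_opp K !=set0 by exists (- 0), 0.
have := lattice_rogers_shephard n_ge1 K0 cK bK oK0 (convex_opp cK)
  (coord_bounded_opp bK).
(* For [L = set_opp K] the intersection is [K] itself, and by reflection both enlarged sets have the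
   same count, whence the square. *)
rewrite set_oppK setIid minkowski_opp_cube lattice_count_opp; last first.
  exact: coord_bounded_minkowski bK (@coord_bounded_open_cube R n 1).
move: (cube_vol_ratio _ _) => c.
by rewrite mulrA ler_pdivlMr // expr2 !mulrA.
Qed.
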